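(* Let $r\geq 1$ be an integer and let $t=1260r+169$. Then for every integer $n\geq 540t^2+\frac{175811}{2}t+\frac{7989}{2}$, $$f(n)\geq n+36t,$$ where $f(n)$ denotes the maximum number of edges in a graph on $n$ vertices in which no two distinct cycles have the same length.
   Context: Graphs are finite and undirected, and loops and multiple edges are allowed. A cycle is a connected subgraph in which every vertex has degree 2 (a loop contributing 2 to the degree of its vertex); its length is its number of edges. Thus a loop is a cycle of length 1, and a pair of parallel edges forms a cycle of length 2. Two cycles are distinct if they are different as subgraphs (equivalently, have different edge sets). For a positive integer $n$, $f(n)$ is the maximum number of edges in a graph on $n$ vertices in which any two distinct cycles have different lengths. *)

(* Defs.v *)
From mathcomp Require Import all_boot.

Set Implicit Arguments.
Unset Strict Implicit.
Unset Printing Implicit Defensive.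

Section Multigraph.
Variables V E : finType.

(* A multigraph with vertex type V and edge type E maps each edge to its pair
   of ends.  Every notion below is invariant under swapping the two ends of an
   edge, so the graphs are undirected; loops are the edges with G e = (v, v). *)
Definition mgraph := {ffun E -> V * V}.

Variable G : mgraph.

(* Candidate subgraphs are pairs (vertex set, edge set). *)
Implicit Type H : {set V} * {set E}.

Definition is_subgraph H : bool :=
  [forall e in H.2, ((G e).1 \in H.1) && ((G e).2 \in H.1)].

(* A loop at v contributes 2. *)
Definition degree H (v : V) : nat :=
  \sum_(e in H.2) (((G e).1 == v) + ((G e).2 == v)).

Definition adjacent H : rel V :=
  [rel u v | [exists e in H.2, (G e == (u, v)) || (G e == (v, u))]].

Definition is_connected H : bool :=
  (H.1 != set0) &&
  [forall u in H.1, forall v in H.1, connect (adjacent H) u v].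

Definition is_cycle H : bool :=
  [&& is_subgraph H, is_connected H & [forall v in H.1, degree H v == 2]].

Definition cycle_length H : nat := #|H.2|.

Definition distinct_cycle_lengths : bool :=
  [forall C, forall D,
     [&& is_cycle C, is_cycle D & C != D] ==>
     (cycle_length C != cycle_length D)].

End Multigraph.

(* Up to isomorphism, 'I_n and 'I_m are the only vertex and edge types of a
   graph with n vertices and m edges. *)
Definition realizable (n : nat) : pred nat :=
  fun m => [exists G : mgraph 'I_n 'I_m, distinct_cycle_lengths G].

Lemma realizable_ex n : exists m, realizable n m.
Proof.
exists 0; apply/existsP; exists (ffun0 (card_ord 0)).
apply/forallP => C; apply/forallP => D; apply/implyP => /and3P[/and3P[_]].
move=> /andP[/set0Pn[v vC] _] /forall_inP/(_ v vC).
by rewrite /degree big1 // => -[].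
Qed.

Section Bound.
Variables V E : finType.
Variable G : mgraph V E.

Lemma loop_is_cycle e v : G e = (v, v) -> is_cycle G ([set v], [set e]).
Proof.
move=> Ge; apply/and3P; split.
- by apply/forall_inP => x /set1P ->; rewrite Ge /= set11.
- apply/andP; split; first by apply/set0Pn; exists v; rewrite set11.
  by apply/forall_inP => x /set1P ->; apply/forall_inP => y /set1P ->.
- by apply/forall_inP => x /set1P ->; rewrite /degree /= big_set1 Ge eqxx.
Qed.

Lemma digon_is_cycle a b u v :
  a != b -> u != v -> G a = (u, v) -> G b = (u, v) ->
  is_cycle G ([set u; v], [set a; b]).
Proof.
move=> ab uv Ga Gb; apply/and3P; split.
- by apply/forall_inP => x /set2P[] ->; rewrite ?Ga ?Gb /= !inE !eqxx orbT.
- apply/andP; split; first by apply/set0Pn; exists u; rewrite !inE eqxx.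
  have auv : adjacent G ([set u; v], [set a; b]) u v.
    by apply/exists_inP; exists a; rewrite ?inE ?Ga !eqxx.
  have avu : adjacent G ([set u; v], [set a; b]) v u.
    by apply/exists_inP; exists a; rewrite ?inE ?Ga !eqxx ?orbT.
  by apply/forall_inP => x /set2P[] ->; apply/forall_inP => y /set2P[] ->;
    rewrite ?connect0 //; exact: connect1.
- apply/forall_inP => x xuv; rewrite /degree /= big_setU1 ?inE //= big_set1.
  have vu : (v == u) = false by rewrite eq_sym (negPf uv).
  by case/set2P: xuv => ->; rewrite Ga Gb /= !eqxx ?(negPf uv) ?vu.
Qed.

Lemma distinct_cycle_lengths_bound :
  distinct_cycle_lengths G -> #|E| <= #|V| * #|V| * 2.
Proof.
move=> /forallP dG.
have dist C D : is_cycle G C -> is_cycle G D -> C != D ->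
    cycle_length C != cycle_length D.
  by move=> cC cD CD; move/forallP: (dG C) => /(_ D) /implyP; apply; apply/and3P.
rewrite -cardsT -sum1_card (partition_big G predT) //= -card_prod -sum_nat_const.
apply: leq_sum => -[u v] _; rewrite sum1dep_card leqNgt; apply/negP.
case/card_gt2P => a [b [c [[]]]]; rewrite !inE /=.
move=> /eqP Ga /eqP Gb /eqP Gc [ab bc ca].
have [uv|uv] := eqVneq u v.
  rewrite -uv in Ga Gb.
  have := dist _ _ (loop_is_cycle Ga) (loop_is_cycle Gb).
  rewrite /cycle_length /= !cards1 eqxx => /(_ _)/negP; case=> //.
  by apply: contra ab => /eqP[/set1_inj ->].
have := dist _ _ (digon_is_cycle ab uv Ga Gb) (digon_is_cycle bc uv Gb Gc).
rewrite /cycle_length /= !cards2 ab bc eqxx => /(_ _)/negP; case=> //.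
apply/eqP => -[] /setP/(_ a); rewrite !inE eqxx (negPf ab) /=.
by rewrite eq_sym (negPf ca).
Qed.

End Bound.

Lemma realizable_bound n m : realizable n m -> m <= n * n * 2.
Proof.
by case/existsP => G /distinct_cycle_lengths_bound; rewrite !card_ord.
Qed.

(* The maximum number of edges in a graph on n vertices in which any two
   distinct cycles have different lengths. *)
Definition max_edges (n : nat) : nat :=
  ex_maxn (realizable_ex n) (@realizable_bound n).

(* Main.v *)
(** Blocks are glued at one vertex x so that G - x is a forest; each vertex then
    has a parent, the roots having parent x, and every non-tree edge is incident
    to x.  For a subgraph with all degrees 2, the parity of the cut below a vertex
    v says that the parent edge of v is present iff an odd number of the non-tree
    edges used are below v.  So a cycle is determined by its non-tree edges, and
    since x has degree 2 there are at most two of them, in the same block.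

    A block consists of a spine starting at x and of spokes from x to the spine.
    If the spoke of length S ends at distance Q from x along the spine (and the
    edge closing the spine counts as a spoke of length 1), the cycle lengths are
    the numbers Q + S and |Q - Q'| + S + S'.  Consecutive spokes give the short
    cycles of the block, one per unit of cycle rank; the number of edges of the
    block is the sum of the short lengths minus the lengths of the inner spokes.
    The spokes are thus made as long as possible, subject to the other cycles
    being longer than all short ones.

    Write T = 1260 r.  Single cycles take the lengths below 24780 r + O(1), theta
    graphs the next ones up to alpha = 34860 r + O(1), and T - 20 blocks with 12
    spokes the lengths above.  The j-th short cycle (0 <= j <= 10) of the i-th such
    block has length alpha + j T + i + O(1), and the j-th inner spoke has length
    (alpha + (2 * floor(j / 2) - 10) T) / 2 + O(1), so that the cycles made of m
    consecutive short ones have lengths in progressions of difference m; these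
    fill an interval lying after that for m - 1, with at most m progressions
    overlapping at a time.  The bounded terms are chosen so that overlapping
    progressions lie in different residue classes mod m; this does not depend on
    r because their first terms have coefficients of r that agree mod m. *)

Require Import Defs.
From mathcomp Require Import all_boot zify.
From Stdlib Require Import NArith Reals Lra.

Set Implicit Arguments.
Unset Strict Implicit.
Unset Printing Implicit Defensive.

(** * Cycles of a forest capped by edges to a root *)

Section TwoRegular.
Variables (V E : finType) (G : mgraph V E).
Implicit Type H : {set V} * {set E}.

Definition two_regular H :=
  [&& is_subgraph G H, H.1 != set0 & [forall v in H.1, degree G H v == 2]].

Lemma is_cycle_two_regular H : is_cycle G H -> two_regular H.
Proof. by case/and3P=> sH /andP[H0 _] dH; apply/and3P. Qed.

Lemma two_regular_degree H v : two_regular H -> degree G H v = (v \in H.1).*2.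
Proof.
case/and3P=> /forall_inP sH _ /forall_inP dH.
have [vH|vH] := boolP (v \in H.1); first exact/eqP/dH.
rewrite /degree big1 // => e /sH/andP[e1 e2].
by apply/eqP; rewrite addn_eq0 !eqb0; apply/andP; split; apply: contra vH => /eqP <-.
Qed.

Lemma sum_eq_in (A : {set V}) x : \sum_(v in A) (x == v) = (x \in A).
Proof.
have [xA|xA] := boolP (x \in A).
  rewrite (bigD1 x) //= eqxx big1 // => v /andP[_].
  by rewrite eq_sym => /negPf ->.
by apply: big1 => v vA; case: eqP xA => // ->; rewrite vA.
Qed.

(** Summing the degrees over [A] counts each edge once per end in [A], and every degree is 0 or
    2. *)
Lemma even_cut H (A : {set V}) : two_regular H ->
  ~~ odd (\sum_(e in H.2) (((G e).1 \in A) + ((G e).2 \in A))).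
Proof.
move=> rH; have -> : \sum_(e in H.2) (((G e).1 \in A) + ((G e).2 \in A)) =
    \sum_(v in A) degree G H v.
  rewrite exchange_big /=; apply: eq_bigr => e _.
  by rewrite big_split /= !sum_eq_in.
apply: (big_ind (fun n => ~~ odd n)) => // [m n em en|v _].
  by rewrite oddD (negPf em).
by rewrite two_regular_degree // odd_double.
Qed.

End TwoRegular.

(** Relabelling by [enum_rank] gives a graph on ordinals, whose cycles pull back to two-regular
    subgraphs with as many edges. *)
Lemma realizable_card (V E : finType) (G : mgraph V E) :
  (forall C D, two_regular G C -> two_regular G D -> #|C.2| = #|D.2| -> C = D) ->
  realizable #|V| #|E|.
Proof.
move=> dG; pose G' : mgraph 'I_#|V| 'I_#|E| :=
  [ffun j => (enum_rank (G (enum_val j)).1, enum_rank (G (enum_val j)).2)].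
pose pull (H : {set 'I_#|V|} * {set 'I_#|E|}) :=
  (enum_rank @^-1: H.1, enum_rank @^-1: H.2) : {set V} * {set E}.
have pull_inj : injective pull.
  have pre_inj (T : finType) (A B : {set 'I_#|T|}) :
      enum_rank @^-1: A = enum_rank @^-1: B -> A = B.
    by move=> /setP AB; apply/setP => i; move: (AB (enum_val i)); rewrite !inE enum_valK.
  by case=> [A B] [C D] [/pre_inj -> /pre_inj ->].
have card_pull K : #|(pull K).2| = #|K.2|.
  by apply: on_card_preimset; apply: onW_bij; apply: enum_rank_bij.
have pullP K : is_cycle G' K -> two_regular G (pull K).
  case/is_cycle_two_regular/and3P => /forall_inP sH H0 /forall_inP dH.
  apply/and3P; split.
  - by apply/forall_inP => e; rewrite !inE => /sH; rewrite ffunE /= enum_rankK.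
  - by case/set0Pn: H0 => v vH; apply/set0Pn; exists (enum_val v); rewrite inE enum_valK.
  - apply/forall_inP => v; rewrite inE => /dH /eqP <-.
    rewrite /degree [in X in _ == X](reindex (@enum_rank E)); last exact/onW_bij/enum_rank_bij.
    apply/eqP/eq_big => e; first by rewrite inE.
    by rewrite ffunE enum_rankK /= !(inj_eq enum_rank_inj).
apply/existsP; exists G'; apply/forallP => C; apply/forallP => D; apply/implyP.
move=> /and3P[/pullP cC /pullP cD]; apply: contra => /eqP; rewrite /cycle_length.
by rewrite -!card_pull => /(dG _ _ cC cD)/pull_inj ->.
Qed.

Section CappedForest.
Variables (W I : finType) (par : W -> option W) (tip : I -> W).
Variables (anc : rel W) (rt : I -> W).
Hypothesis anc_refl : reflexive anc.
Hypothesis anc_par : forall v w, w != v -> anc v w = oapp (anc v) false (par w).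
Hypothesis par_anc : forall v, oapp (anc v) false (par v) = false.
Hypothesis par_rt : forall i, par (rt i) = None.
Hypothesis anc_rt : forall i, anc (rt i) (tip i).

(* [None] is the vertex x, and [anc v w] means that [v] is [w] or an ancestor
   of [w]. *)
Definition capped_forest : mgraph (option W) (W + I)%type :=
  [ffun e => match e with
             | inl w => (Some w, par w)
             | inr i => (Some (tip i), None)
             end].

Implicit Type H : {set option W} * {set W + I}.
Let caps H := [set i | inr i \in H.2].

(** This is [even_cut] for the descendants of [w]: a tree edge other than the one above [w] has both
    ends or neither among them, and x is outside. *)
Lemma parent_edge_in H w : two_regular capped_forest H ->
  (inl w \in H.2) = odd #|[set i in caps H | anc w (tip i)]|.
Proof.
move=> /(even_cut [set o | oapp (anc w) false o]); rewrite big_sumType /=.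
under eq_bigr => v _.
  rewrite ffunE /= !inE /=.
  have -> : anc w v + oapp (anc w) false (par v) =
            (v == w) + (oapp (anc w) false (par v)).*2 :> nat.
    have [->|vw] := eqVneq v w; first by rewrite anc_refl par_anc.
    by rewrite (anc_par vw) addnn.
  over.
rewrite big_split /= -addnA oddD.
have -> : \sum_(v | inl v \in H.2) (v == w) = (inl w \in H.2).
  transitivity (\sum_(v in [set v | inl v \in H.2]) (w == v)).
    by apply: eq_big => v; rewrite ?inE // eq_sym.
  by rewrite sum_eq_in inE.
rewrite oddD [odd (\sum_(i | _) _.*2)]negbTE /=; last first.
  by apply: (big_ind (fun n => ~~ odd n)) => // [m n em en|v _];
    rewrite ?oddD ?(negPf em) ?odd_double.
under eq_bigr => i _ do rewrite ffunE /= !inE /= addn0.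
rewrite oddb -sum1_card; have -> : \sum_(i in [set i in caps H | anc w (tip i)]) 1 =
  \sum_(i | inr i \in H.2) anc w (tip i).
  rewrite [RHS]big_mkcond [LHS]big_mkcond; apply: eq_bigr => i _.
  by rewrite !inE; case: (_ \in _); case: (anc _ _).
by case: (_ \in _); case: odd.
Qed.

Lemma two_regular_caps_inj C D :
  two_regular capped_forest C -> two_regular capped_forest D ->
  caps C = caps D -> C = D.
Proof.
move=> rC rD CD; have E2 : C.2 = D.2.
  apply/setP => -[w|i]; first by rewrite !parent_edge_in // CD.
  by move/setP: CD => /(_ i); rewrite !inE.
(* Equal edge sets give equal degrees, and a vertex is present iff its degree is nonzero. *)
case: C D E2 {CD} rC rD => [A B] [A' B'] /= <- rC rD; congr pair.
apply/setP => v; apply/idP/idP => h.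
  have := two_regular_degree v rD; rewrite /degree /=.
  by have := two_regular_degree v rC; rewrite /degree /= h => ->; case: (v \in A').
have := two_regular_degree v rC; rewrite /degree /=.
by have := two_regular_degree v rD; rewrite /degree /= h => ->; case: (v \in A).
Qed.

Lemma caps_neq0 H : two_regular capped_forest H -> caps H != set0.
Proof.
move=> rH; apply/eqP => c0.
have H0 : H.2 = set0.
  apply/setP => -[w|i]; last by move/setP: c0 => /(_ i); rewrite !inE.
  rewrite parent_edge_in // c0 inE.
  by rewrite (_ : [set _ in _ | _] = set0) ?cards0 //; apply/setP => i; rewrite !inE.
case/and3P: (rH) => _ /set0Pn[v vH] _.
by have := two_regular_degree v rH; rewrite vH /degree H0 big_set0.
Qed.

Lemma caps_degree_root H : two_regular capped_forest H ->
  #|caps H| + #|[set w | (inl w \in H.2) && (par w == None)]| <= 2.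
Proof.
move=> rH; apply: (@leq_trans (degree capped_forest H None)); last first.
  by rewrite two_regular_degree //; case: (_ \in _).
rewrite /degree big_sumType /= addnC -!sum1_card leq_add // big_mkcond [leqRHS]big_mkcond leq_sum // => i _;
  rewrite ffunE !inE /=; case: (_ \in _) => //=.
Qed.

(* With two caps, the degree of x leaves no room for the edge from x to the root
   above [i], so by parity [j] is below that root too. *)
Lemma caps_two H : two_regular capped_forest H ->
  exists i j, caps H = [set i; j] /\ anc (rt i) (tip j).
Proof.
move=> rH; have := caps_degree_root rH; have /set0Pn[i iH] := caps_neq0 rH.
rewrite (cardsD1 i) iH; have [/eqP|] := posnP #|caps H :\ i|.
  rewrite cards_eq0 setD_eq0 subset1 => /orP[/eqP E|/eqP E] _; last by rewrite E inE in iH.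
  by exists i, i; rewrite setUid.
move=> c1 c2; have [c1' c0] : #|caps H :\ i| = 1 /\ #|[set w | (inl w \in H.2) && (par w == None)]| = 0.
  by move: c1 c2; rewrite -addnA add1n ltnS; do 2 case: #|_| => [|[|?]] //.
have /eqP/cards1P[j E] := c1'; exists i, j.
have Eij : caps H = [set i; j] by rewrite -E setD1K.
split=> //; apply: contra_eqT c0 => nij; rewrite cards_eq0; apply/set0Pn.
exists (rt i); rewrite inE par_rt eqxx andbT parent_edge_in // Eij.
rewrite (_ : [set _ in _ | _] = [set i]) ?cards1 //; apply/setP => k.
by rewrite !inE; case: (eqVneq k i) => [->|_] /=; rewrite ?anc_rt //; case: eqP => // ->; exact/negbTE.
Qed.

(** For [i != j] the tree edges used form the symmetric difference of the paths from the two tips to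
    x. *)
Definition capped_length i j :=
  #|[set i; j]| + #|[set w | odd #|[set k in [set i; j] | anc w (tip k)]|]|.

Lemma card_two_regular H i j : two_regular capped_forest H ->
  caps H = [set i; j] -> #|H.2| = capped_length i j.
Proof.
move=> rH Eij; rewrite /capped_length -Eij -!sum1_card big_sumType /= addnC.
congr addn; first by apply: eq_bigl => k; rewrite inE.
by apply: eq_bigl => w; rewrite inE parent_edge_in.
Qed.

Lemma realizable_capped_forest :
  (forall i j i' j', anc (rt i) (tip j) -> anc (rt i') (tip j') ->
     capped_length i j = capped_length i' j' -> [set i; j] = [set i'; j']) ->
  realizable #|W|.+1 (#|W| + #|I|).
Proof.
move=> inj; rewrite -card_option -card_sum.
apply: (@realizable_card _ _ capped_forest) => C D rC rD.
have [i [j [Cij aij]]] := caps_two rC; have [i' [j' [Dij aij']]] := caps_two rD.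
rewrite (card_two_regular rC Cij) (card_two_regular rD Dij) => /(inj _ _ _ _ aij aij').
by rewrite -Cij -Dij => /(two_regular_caps_inj rC rD).
Qed.

Lemma capped_length1 i : capped_length i i = #|[set w | anc w (tip i)]|.+1.
Proof.
rewrite /capped_length setUid cards1 add1n; congr _.+1; apply: eq_card => w; rewrite !inE.
have [a|a] := boolP (anc w (tip i)).
  rewrite (_ : [set _ in _ | _] = [set i]) ?cards1 //; apply/setP => k.
  by rewrite !inE; case: eqP => // ->.
rewrite (_ : [set _ in _ | _] = set0) ?cards0 //; apply/setP => k.
by rewrite !inE; case: eqP => // ->; exact/negbTE.
Qed.

(** Vertex by vertex, the xor of two bits plus twice their conjunction is their sum. *)
Lemma capped_length2 i j : i != j ->
  capped_length i j + 2 * #|[set w | anc w (tip i)] :&: [set w | anc w (tip j)]| =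
  2 + #|[set w | anc w (tip i)]| + #|[set w | anc w (tip j)]|.
Proof.
move=> ij; rewrite /capped_length cards2 ij -!addnA; congr addn.
have cardE (A : {set W}) : #|A| = \sum_w (w \in A).
  by rewrite -sum1_card big_mkcond; apply: eq_bigr => w _; case: (_ \in _).
rewrite !cardE big_distrr -!big_split; apply: eq_bigr => w _.
rewrite !inE; have -> : #|[set k in [set i; j] | anc w (tip k)]| = anc w (tip i) + anc w (tip j).
  rewrite -sum1_card big_mkcond /= (bigD1 i) //= (bigD1 j) 1?eq_sym //= !inE !eqxx orbT /=.
  rewrite big1 ?addn0 => [|k /andP[/negPf ki /negPf kj]]; last by rewrite !inE ki kj.
  by do 2 case: (anc _ _).
by do 2 case: (anc _ _).
Qed.

End CappedForest.

(** * Blocks made of ears *)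

Section Ears.
Variables (I : finType) (mn : I -> I) (att len : I -> nat) (p : nat).
Hypothesis mnK : forall e, mn (mn e) = mn e.
Hypothesis att_eq0 : forall e, (att e == 0) = (mn e == e).
Hypothesis att_le : forall e, att e <= len (mn e).
Hypothesis len_gt0 : forall e, 0 < len e.

(* Ear [e] consists of [len e] vertices, whose last one is joined to x, and starts
   at distance [att e] from x on the spine [mn e]; spines are the ears with
   [att e = 0].  The index [None] stands for a path of [p] vertices attached to x
   and creating no cycle, which pads the vertex count. *)
Definition ear_size (o : option I) := oapp len p o.
Definition ear_vertex : finType := {o : option I & 'I_(ear_size o)}.
Definition ear_pos (w : ear_vertex) : nat := tagged w.
Definition ear_at (o : option I) k : option ear_vertex :=
  omap (existT (fun o => 'I_(ear_size o)) o) (insub k).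

Lemma ear_atP o k : k < ear_size o ->
  exists2 w : ear_vertex, ear_at o k = Some w & tag w = o /\ ear_pos w = k.
Proof.
move=> ltk; exists (existT (fun o => 'I_(ear_size o)) o (Ordinal ltk)) => //.
by rewrite /ear_at insubT.
Qed.

Lemma ear_vertex_inj (v w : ear_vertex) : tag v = tag w -> ear_pos v = ear_pos w -> v = w.
Proof.
case: v w => [o i] [o' j] /= oo; case: o' / oo j => j; rewrite /ear_pos /= => ij.
by congr existT; apply: val_inj.
Qed.

Lemma ear_pos_lt (w : ear_vertex) : ear_pos w < ear_size (tag w).
Proof. exact: ltn_ord. Qed.

Definition ear_parent (w : ear_vertex) : option ear_vertex :=
  if ear_pos w is k.+1 then ear_at (tag w) k
  else if tag w is Some e then if att e is k.+1 then ear_at (Some (mn e)) k else None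
  else None.

Definition ear_anc : rel ear_vertex := fun v w =>
  if tag v == tag w then ear_pos v <= ear_pos w
  else if tag w is Some f then (tag v == Some (mn f)) && (ear_pos v < att f) else false.

Lemma ear_last_subproof e : (len e).-1 < ear_size (Some e).
Proof. by rewrite /= prednK. Qed.

Definition ear_tip e : ear_vertex :=
  existT (fun o => 'I_(ear_size o)) (Some e) (Ordinal (ear_last_subproof e)).

Definition ear_root e : ear_vertex :=
  existT (fun o => 'I_(ear_size o)) (Some (mn e)) (Ordinal (len_gt0 (mn e) : 0 < ear_size (Some (mn e)))).

Lemma att_mn e : att (mn e) = 0.
Proof. by apply/eqP; rewrite att_eq0 mnK. Qed.

Lemma ear_anc_refl : reflexive ear_anc.
Proof. by move=> v; rewrite /ear_anc eqxx. Qed.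

Lemma ear_anc_parent v w : w != v -> ear_anc v w = oapp (ear_anc v) false (ear_parent w).
Proof.
move=> wv; have neq : tag v = tag w -> ear_pos v <> ear_pos w.
  by move=> tvw pvw; move: wv; rewrite (ear_vertex_inj tvw pvw) eqxx.
rewrite /ear_parent; move: neq; rewrite /ear_anc; case Ew: (ear_pos w) => [|k]; last first.
  have kl : k < ear_size (tag w) by apply: leq_trans (ear_pos_lt w); rewrite Ew.
  have [u -> [tu pu]] := ear_atP kl; rewrite /= tu pu.
  by case: eqP => // tv /(_ tv) /eqP ne; rewrite leq_eqVlt (negPf ne).
case tw: (tag w) => [f|]; last first.
  by case: eqP => // tv /(_ tv); rewrite leqn0 => /eqP/negbTE.
have := att_eq0 f; have := att_le f; case af: (att f) => [|k] //=.
  move=> _ /esym/eqP mf; case: eqP => [tv /(_ tv)|_ _]; last by rewrite ltn0 andbF.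
  by rewrite leqn0 => /eqP/negbTE.
move=> kl /esym nf; have [u -> [tu pu]] := @ear_atP (Some (mn f)) k kl.
rewrite /= tu pu mnK att_mn ltn0 andbF; case: eqP => [tv /(_ tv)|_ _]; last first.
  by case: eqP.
by rewrite leqn0 => /eqP/negbTE ->; rewrite tv; case: eqP => // -[/esym/eqP]; rewrite nf.
Qed.

Lemma ear_parent_anc v : oapp (ear_anc v) false (ear_parent v) = false.
Proof.
rewrite /ear_parent /ear_anc; case Ev: (ear_pos v) => [|k]; last first.
  have kl : k < ear_size (tag v) by apply: leq_trans (ear_pos_lt v); rewrite Ev.
  by have [u -> [tu pu]] := ear_atP kl; rewrite /= tu pu eqxx ltnn.
case tv: (tag v) => [f|] //; have := att_eq0 f; have := att_le f.
case af: (att f) => [|k] //= kl /esym nf.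
have [u -> [tu pu]] := @ear_atP (Some (mn f)) k kl.
by rewrite /= tu att_mn ltn0 andbF; case: eqP => // -[/esym/eqP]; rewrite nf.
Qed.

Lemma ear_parent_root e : ear_parent (ear_root e) = None.
Proof. by rewrite /ear_parent /= att_mn. Qed.

Lemma ear_anc_root e : ear_anc (ear_root e) (ear_tip e).
Proof.
rewrite /ear_anc /=; case: eqP => // ne; rewrite eqxx /=.
by rewrite lt0n att_eq0; apply/eqP => me; case: ne; rewrite me.
Qed.

Lemma ear_anc_rootE e f : ear_anc (ear_root e) (ear_tip f) -> mn e = mn f.
Proof.
rewrite /ear_anc /=; case: eqP => [[<-] _|_]; first by rewrite mnK.
by case/andP => /eqP[].
Qed.

(** These are Q and S of the overview. *)
Definition ear_height e := if att e == 0 then len e else att e.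
Definition ear_reach e := if att e == 0 then 1 else (len e).+1.

Definition segment (o : option I) k := [set w : ear_vertex | (tag w == o) && (ear_pos w < k)].

Lemma card_segment o k : k <= ear_size o -> #|segment o k| = k.
Proof.
move=> kl; rewrite -sum1_card.
transitivity (\sum_(o' | o' == o) \sum_(x : 'I_(ear_size o') | x < k) 1).
  by rewrite sig_big_dep; apply: eq_bigl => w; rewrite inE.
by rewrite big_pred1_eq (@big_ord_narrow _ _ _ _ _ (fun=> 1) kl) sum1_card card_ord.
Qed.

Lemma ear_height_le e : ear_height e <= len (mn e).
Proof. by rewrite /ear_height att_eq0; case: eqP => [->|_]. Qed.

Lemma card_ear_anc e :
  #|[set w | ear_anc w (ear_tip e)]|.+1 = ear_height e + ear_reach e.
Proof.
have lt_last k : (k <= (len e).-1) = (k < len e) by rewrite -ltnS prednK.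
rewrite /ear_reach; case: ifP => [a0|an0].
  rewrite addn1; congr _.+1; rewrite -[RHS](@card_segment (Some (mn e)) _ (ear_height_le e)).
  have me : mn e = e by apply/eqP; rewrite -att_eq0.
  apply: eq_card => w; rewrite !inE /ear_anc /ear_height a0 me /=.
  by case: eqP => //= _; rewrite (eqP a0) andbF.
rewrite addnS; congr _.+1; have := an0; rewrite att_eq0 => /negbT nme.
rewrite -[in RHS](@card_segment (Some (mn e)) _ (ear_height_le e)).
rewrite -[in RHS](@card_segment (Some e) (len e) (leqnn _)) -cardsUI.
rewrite [X in _ + X](_ : _ = 0) ?addn0.
  apply: eq_card => w; rewrite !inE /ear_anc /ear_height an0 /= lt_last.
  by case: (eqVneq (tag w) (Some e)) => [->|_]; rewrite ?orbF // (inj_eq Some_inj) eq_sym (negPf nme).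
apply/eqP; rewrite cards_eq0; apply/eqP/setP => w; rewrite !inE.
by case: (eqVneq (tag w) (Some e)) => [->|_]; rewrite ?andbF // (inj_eq Some_inj) eq_sym (negPf nme).
Qed.

(** Distinct ears of a block share only spine vertices, and their initial segments of the spine are
    nested. *)
Lemma card_ear_ancI e f : e != f -> mn e = mn f ->
  #|[set w | ear_anc w (ear_tip e)] :&: [set w | ear_anc w (ear_tip f)]| =
  minn (ear_height e) (ear_height f).
Proof.
have lt_last g k : (k <= (len g).-1) = (k < len g) by rewrite -ltnS prednK.
move=> nef mef; rewrite -[RHS](@card_segment (Some (mn e))); last first.
  by rewrite geq_min ear_height_le.
apply: eq_card => w; rewrite !inE /ear_anc /ear_height leq_min /= !lt_last.
have := att_eq0 e; have := att_eq0 f; rewrite -mef.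
case: (eqVneq (tag w) (Some e)) => [->|twe].
  rewrite (inj_eq Some_inj) (negPf nef) (inj_eq Some_inj) [e == mn e]eq_sym.
  case: (eqVneq (mn e) e) => [->|_] fe ee; last by rewrite andbF.
  by rewrite ee fe (negPf nef) andbC.
case: (eqVneq (tag w) (Some f)) => [->|twf].
  rewrite (inj_eq Some_inj) [f == mn e]eq_sym.
  case: (eqVneq (mn e) f) => [->|_] fe ee //.
  by rewrite fe ee eq_sym (negPf nef).
case: (eqVneq (tag w) (Some (mn e))) => //= twm fe ee.
have -> : (att e == 0) = false by rewrite ee; apply/eqP => me; rewrite -me twm eqxx in twe.
by have -> : (att f == 0) = false by rewrite fe; apply/eqP => me; rewrite -me twm eqxx in twf.
Qed.

Definition ear_cycle_length e f :=
  if e == f then ear_height e + ear_reach e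
  else (ear_height e - ear_height f) + (ear_height f - ear_height e) + ear_reach e + ear_reach f.

Lemma capped_length_ear e f : mn e = mn f ->
  capped_length ear_tip ear_anc e f = ear_cycle_length e f.
Proof.
move=> mef; rewrite /ear_cycle_length; case: eqP => [<-|/eqP nef].
  by rewrite capped_length1 card_ear_anc.
have := capped_length2 ear_tip ear_anc nef.
have := card_ear_anc e; have := card_ear_anc f; rewrite (card_ear_ancI nef mef).
set a := #|_|; set b := #|_|; lia.
Qed.

Lemma card_ear_vertex : #|ear_vertex| = p + \sum_e len e.
Proof.
rewrite -sum1_card -(sig_big_dep xpredT (fun _ => xpredT) (fun _ _ => 1)) /=.
under eq_bigr => o _ do rewrite sum1_card card_ord.
rewrite (bigD1 None) //=; congr addn.
rewrite (reindex_omap Some (fun o => o)) //=; last by case.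
by apply: eq_bigl => e; rewrite eqxx.
Qed.

Theorem realizable_ears :
  (forall e f e' f', mn e = mn f -> mn e' = mn f' ->
     ear_cycle_length e f = ear_cycle_length e' f' -> [set e; f] = [set e'; f']) ->
  realizable (p + \sum_e len e).+1 (p + \sum_e len e + #|I|).
Proof.
move=> inj; rewrite -card_ear_vertex.
apply: (realizable_capped_forest ear_anc_refl ear_anc_parent ear_parent_anc
  ear_parent_root ear_anc_root).
move=> e f e' f' /ear_anc_rootE ef /ear_anc_rootE ef'.
by rewrite !capped_length_ear //; apply: inj.
Qed.

End Ears.

(** * Families of blocks with affine parameters *)

(* [(a, b, c)] stands for a r + b + c i, where i is the number of the copy. *)
Definition affine := (N * N * N)%type.

Definition aeval (r : nat) (c : affine) (i : nat) : nat :=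
  N.to_nat c.1.1 * r + N.to_nat c.1.2 + N.to_nat c.2 * i.

Definition aadd (c d : affine) : affine :=
  (N.add c.1.1 d.1.1, N.add c.1.2 d.1.2, N.add c.2 d.2).
Definition asub (c d : affine) : affine :=
  (N.sub c.1.1 d.1.1, N.sub c.1.2 d.1.2, N.sub c.2 d.2).
Definition ale (c d : affine) :=
  [&& N.leb c.1.1 d.1.1, N.leb c.1.2 d.1.2 & N.leb c.2 d.2].

Lemma aevalD r c d i : aeval r (aadd c d) i = aeval r c i + aeval r d i.
Proof. rewrite /aeval /=; lia. Qed.

Lemma aevalB r c d i : ale d c -> aeval r (asub c d) i = aeval r c i - aeval r d i.
Proof.
case: c d => [[c1 c2] c3] [[d1 d2] d3] /and3P[/N.leb_le /= h1 /N.leb_le /= h2 /N.leb_le /= h3].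
rewrite /aeval /=; have e1 : c1 = N.add d1 (N.sub c1 d1) by lia.
have e2 : c2 = N.add d2 (N.sub c2 d2) by lia.
have e3 : c3 = N.add d3 (N.sub c3 d3) by lia.
move: (N.sub c1 d1) (N.sub c2 d2) (N.sub c3 d3) e1 e2 e3 => k1 k2 k3 -> -> ->; lia.
Qed.

Lemma aeval_le r c d i : ale c d -> aeval r c i <= aeval r d i.
Proof.
case: c d => [[c1 c2] c3] [[d1 d2] d3] /and3P[/N.leb_le /= h1 /N.leb_le /= h2 /N.leb_le /= h3].
by rewrite /aeval /= !leq_add // ?leq_mul2r; try (apply/orP; right); lia.
Qed.

(* The number of copies, as a r + b, and the list of the pairs (Q, S), starting
   with the spine (for which S = 1) and with Q decreasing. *)
Definition fan_family := ((N * N) * seq (affine * affine))%type.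
Implicit Type F : fan_family.

Definition copies (r : nat) F := N.to_nat F.1.1 * r + N.to_nat F.1.2.
Definition ear0 : affine * affine := ((0, 0, 0), (0, 0, 0))%num.
Definition height F j := (nth ear0 F.2 j).1.
Definition reach F j := (nth ear0 F.2 j).2.

(** Strict bounds on the constant terms hold for all r and i. A spoke needs S >= 2 to have a vertex
    of its own. *)
Definition wf_family F :=
  (reach F 0 == (0, 1, 0)%num) &&
  all (fun j => [&& N.ltb 0 (height F j).1.2, (j == 0) || N.ltb 1 (reach F j).1.2 &
                 all (fun i => ale (height F j) (height F i)) (iota 0 j)])
      (iota 0 (size F.2)).

Definition cycle_affine F a b :=
  if a == b then aadd (height F a) (reach F a)
  else aadd (asub (height F a) (height F b)) (aadd (reach F a) (reach F b)).

(** Compares the last copy [i = m - 1] of [c] with the first copy of [d]; adding the step on the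
    right avoids a subtraction. *)
Definition precedes (m : N * N) (c d : affine) :=
  N.leb (N.add c.1.1 (N.mul c.2 m.1)) d.1.1 &&
  N.ltb (N.add c.1.2 (N.mul c.2 m.2)) (N.add d.1.2 c.2).

(** Modulo the gcd of the steps the copy numbers vanish and the terms in r agree, so the constant
    terms decide. *)
Definition incongruent (c d : affine) :=
  let g := N.gcd c.2 d.2 in
  (N.modulo c.1.1 g == N.modulo d.1.1 g) && (N.modulo c.1.2 g != N.modulo d.1.2 g).

Lemma precedesP r m c d i i' : i < N.to_nat m.1 * r + N.to_nat m.2 ->
  precedes m c d -> aeval r c i < aeval r d i'.
Proof.
case: m c d => [m1 m2] [[c1 c2] c3] [[d1 d2] d3] /= im /andP[/N.leb_le /= h1 /N.ltb_lt /= h2].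
rewrite /aeval /=; nia.
Qed.

Lemma incongruentP r c d i i' : incongruent c d -> aeval r c i != aeval r d i'.
Proof.
case: c d => [[c1 c2] c3] [[d1 d2] d3]; rewrite /incongruent /=.
set g := N.gcd c3 d3; move=> /andP[/eqP e1 /eqP ne2].
apply/eqP => E; apply: ne2.
have E' : N.add (N.add c2 (N.mul c1 (N.of_nat r))) (N.mul c3 (N.of_nat i)) =
          N.add (N.add d2 (N.mul d1 (N.of_nat r))) (N.mul d3 (N.of_nat i')).
  by move: E; rewrite /aeval /=; lia.
have [u cu] : N.divide g c3 := N.gcd_divide_l c3 d3.
have [v dv] : N.divide g d3 := N.gcd_divide_r c3 d3.
have c1E := N.Div0.div_mod c1 g; have d1E := N.Div0.div_mod d1 g.
rewrite -e1 in d1E; rewrite -(N.Div0.mod_add c2 (N.add (N.mul (N.div c1 g) (N.of_nat r)) (N.mul u (N.of_nat i)))).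
rewrite -(N.Div0.mod_add d2 (N.add (N.mul (N.div d1 g) (N.of_nat r)) (N.mul v (N.of_nat i')))).
congr N.modulo; move: (N.div c1 g) (N.div d1 g) (N.modulo c1 g) E' c1E d1E cu dv {e1}.
by clearbody g => q q' m E' c1E d1E cu dv; subst c1 d1 c3 d3; lia.
Qed.

Section Design.
Variable D : seq fan_family.
Definition fam k : fan_family := nth ((0, 0)%num, [::]) D k.

(* [(k, a, b)] stands for the cycle through the ears [a <= b] of a block of
   family [k], using the ear [a] only when [a = b]. *)
Definition cycle_keys : seq (nat * nat * nat) :=
  flatten [seq [seq (k, a, b) | a <- iota 0 (size (fam k).2), b <- iota a (size (fam k).2 - a)]
          | k <- iota 0 (size D)].
Definition key_affine x := cycle_affine (fam x.1.1) x.1.2 x.2.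

Definition separated x y :=
  [|| precedes (fam x.1.1).1 (key_affine x) (key_affine y),
      precedes (fam y.1.1).1 (key_affine y) (key_affine x)
    | incongruent (key_affine x) (key_affine y)].

(** A finite check free of r, in binary numbers so that it can be computed. The positive step
    separates copies of the same cycle. *)
Definition wf_design :=
  all (fun k => wf_family (fam k)) (iota 0 (size D)) &&
  all (fun x => all (fun y => if x == y then N.ltb 0 (key_affine x).2 else separated x y)
                    cycle_keys) cycle_keys.

Lemma mem_cycle_keys k a b : k < size D -> a <= b < size (fam k).2 -> (k, a, b) \in cycle_keys.
Proof.
move=> kD /andP[ab bs]; apply/flatten_mapP; exists k; first by rewrite mem_iota.
apply/allpairsPdep; exists a, b; split=> //; rewrite mem_iota /=; first by lia.
by apply/andP; split; lia.
Qed.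

Variable r : nat.

Definition ear_index : finType :=
  {k : 'I_(size D) & ('I_(copies r (fam k)) * 'I_(size (fam k).2))%type}.
Implicit Types e f : ear_index.
Definition fam_of e : nat := tag e.
Definition copy_of e : nat := (tagged e).1.
Definition slot_of e : nat := (tagged e).2.

Lemma fam_of_lt e : fam_of e < size D. Proof. exact: ltn_ord. Qed.
Lemma copy_of_lt e : copy_of e < copies r (fam (fam_of e)). Proof. exact: ltn_ord. Qed.
Lemma slot_of_lt e : slot_of e < size (fam (fam_of e)).2. Proof. exact: ltn_ord. Qed.

Lemma ear_index_inj e f :
  fam_of e = fam_of f -> copy_of e = copy_of f -> slot_of e = slot_of f -> e = f.
Proof.
case: e f => [k [i j]] [k' [i' j']]; rewrite /fam_of /= => /val_inj kk.
case: k' / kk i' j' => i' j'; rewrite /copy_of /slot_of /= => ii jj.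
by congr existT; congr pair; apply: val_inj.
Qed.

Definition spine_of e : ear_index :=
  let: existT k ij := e in
  existT _ k (ij.1, Ordinal (leq_ltn_trans (leq0n ij.2) (ltn_ord ij.2))).

Lemma fam_of_spine e : fam_of (spine_of e) = fam_of e. Proof. by case: e => k []. Qed.
Lemma copy_of_spine e : copy_of (spine_of e) = copy_of e. Proof. by case: e => k []. Qed.
Lemma slot_of_spine e : slot_of (spine_of e) = 0. Proof. by case: e => k []. Qed.

Lemma spine_of_eq e f : (spine_of e = spine_of f) <->
  (fam_of e = fam_of f /\ copy_of e = copy_of f).
Proof.
split=> [ef|[kef ief]].
  by rewrite -fam_of_spine -copy_of_spine ef fam_of_spine copy_of_spine.
by apply: ear_index_inj; rewrite ?fam_of_spine ?copy_of_spine ?slot_of_spine.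
Qed.

Definition height_of e := aeval r (height (fam (fam_of e)) (slot_of e)) (copy_of e).
Definition reach_of e := aeval r (reach (fam (fam_of e)) (slot_of e)) (copy_of e).
Definition att_of e := if slot_of e == 0 then 0 else height_of e.
Definition len_of e := if slot_of e == 0 then height_of e else (reach_of e).-1.

Hypothesis wfD : wf_design.

Lemma wf_fam e : wf_family (fam (fam_of e)).
Proof.
by case/andP: wfD => /allP wD _; apply: wD; rewrite mem_iota fam_of_lt.
Qed.

Lemma wf_slot e : [/\ 0 < height_of e, slot_of e != 0 -> 1 < reach_of e &
  forall f, fam_of f = fam_of e -> copy_of f = copy_of e -> slot_of e <= slot_of f ->
    ale (height (fam (fam_of e)) (slot_of f)) (height (fam (fam_of e)) (slot_of e))].
Proof.
case/andP: (wf_fam e) => _ /allP wF.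
have /wF/and3P[h1 h2 _] : slot_of e \in iota 0 (size (fam (fam_of e)).2).
  by rewrite mem_iota slot_of_lt.
split.
- by rewrite /height_of /aeval; move/N.ltb_lt: h1; lia.
- by move=> /negPf s0; move: h2; rewrite s0 /= => /N.ltb_lt; rewrite /reach_of /aeval; lia.
- move=> f kf _; rewrite leq_eqVlt => /orP[/eqP <-|sef].
    by apply/and3P; split; apply/N.leb_le; lia.
  have /wF/and3P[_ _ /allP] : slot_of f \in iota 0 (size (fam (fam_of e)).2).
    by rewrite mem_iota -kf slot_of_lt.
  by apply; rewrite mem_iota.
Qed.

Lemma spine_of_id e : (spine_of e == e) = (slot_of e == 0).
Proof.
apply/eqP/eqP => [<-|s0]; first by rewrite slot_of_spine.
by apply: ear_index_inj; rewrite ?fam_of_spine ?copy_of_spine ?slot_of_spine.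
Qed.

Lemma att_of_eq0 e : (att_of e == 0) = (spine_of e == e).
Proof.
rewrite spine_of_id /att_of; case: (slot_of e == 0) => //.
by case: (wf_slot e); case: (height_of e).
Qed.

Lemma height_of_anti e f : spine_of e = spine_of f -> slot_of e <= slot_of f ->
  height_of f <= height_of e.
Proof.
case/spine_of_eq => kef ief sef; rewrite /height_of -kef -ief; apply: aeval_le.
by case: (wf_slot e) => _ _ /(_ f); apply.
Qed.

Lemma spine_ofK e : spine_of (spine_of e) = spine_of e.
Proof. by apply/spine_of_eq; rewrite fam_of_spine copy_of_spine. Qed.

Lemma len_of_spine e : len_of (spine_of e) = height_of (spine_of e).
Proof. by rewrite /len_of slot_of_spine. Qed.

Lemma att_of_le e : att_of e <= len_of (spine_of e).
Proof.
rewrite len_of_spine /att_of; case: eqP => // _; apply: height_of_anti.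
  exact: spine_ofK.
by rewrite slot_of_spine.
Qed.

Lemma len_of_gt0 e : 0 < len_of e.
Proof.
rewrite /len_of; case: (wf_slot e) => h1 h2 _; case: eqP => // /eqP/h2.
by case: reach_of => [|[]].
Qed.

Lemma ear_height_of e : ear_height att_of len_of e = height_of e.
Proof.
rewrite /ear_height att_of_eq0 spine_of_id /len_of /att_of.
by case: (slot_of e == 0).
Qed.

Lemma ear_reach_of e : ear_reach att_of len_of e = reach_of e.
Proof.
rewrite /ear_reach att_of_eq0 spine_of_id /len_of.
have [s0|/eqP s0] := eqP; last by case: (wf_slot e) => _ /(_ s0); case: reach_of.
by case/andP: (wf_fam e) => /eqP r0 _; rewrite /reach_of s0 r0 /aeval /= !mul0n.
Qed.

Lemma ear_cycle_length_le e f : spine_of e = spine_of f -> slot_of e <= slot_of f ->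
  ear_cycle_length att_of len_of e f =
  aeval r (key_affine (fam_of e, slot_of e, slot_of f)) (copy_of e).
Proof.
move=> sp sl; have [kef ief] := (spine_of_eq e f).1 sp.
rewrite /ear_cycle_length !ear_height_of !ear_reach_of /key_affine /cycle_affine /=.
case: (eqVneq (slot_of e) (slot_of f)) => [sef|sef].
  by rewrite (ear_index_inj kef ief sef) eqxx aevalD.
rewrite ifN; last by apply: contraNneq sef => ->.
rewrite !aevalD aevalB; last by case: (wf_slot e) => _ _; apply.
have := height_of_anti sp sl; rewrite /height_of /reach_of -kef -ief; lia.
Qed.

Lemma ear_cycle_lengthC e f : ear_cycle_length att_of len_of e f = ear_cycle_length att_of len_of f e.
Proof. by rewrite /ear_cycle_length eq_sym; case: eqP => [->|_] //; lia. Qed.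

Lemma cycle_length_inj e f e' f' :
  spine_of e = spine_of f -> spine_of e' = spine_of f' ->
  ear_cycle_length att_of len_of e f = ear_cycle_length att_of len_of e' f' ->
  [set e; f] = [set e'; f'].
Proof.
wlog le : e f / slot_of e <= slot_of f => [wl|].
  case/orP: (leq_total (slot_of e) (slot_of f)) => h sp sp' E; first exact: wl.
  by rewrite setUC; apply: wl; rewrite // ear_cycle_lengthC.
wlog le' : e' f' / slot_of e' <= slot_of f' => [wl|].
  case/orP: (leq_total (slot_of e') (slot_of f')) => h sp sp' E; first exact: wl.
  by rewrite [RHS]setUC; apply: wl; rewrite // [RHS]ear_cycle_lengthC.
move=> sp sp'; rewrite !ear_cycle_length_le //.
have [kef ief] := (spine_of_eq e f).1 sp; have [kef' ief'] := (spine_of_eq e' f').1 sp'.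
set x := (fam_of e, _, _); set y := (fam_of e', _, _) => E.
have xK : x \in cycle_keys by rewrite mem_cycle_keys ?fam_of_lt ?le // kef slot_of_lt.
have yK : y \in cycle_keys by rewrite mem_cycle_keys ?fam_of_lt ?le' // kef' slot_of_lt.
case/andP: wfD => _ /allP/(_ x xK)/allP/(_ y yK).
have [xy|_] := eqVneq x y.
  move=> /N.ltb_lt pos; case: (xy) => kk ss ss'.
  have ii : copy_of e = copy_of e' by move: E; rewrite -xy /aeval; nia.
  have -> : e = e' by apply: ear_index_inj.
  by have -> : f = f' by apply: ear_index_inj; rewrite -?kef -?kef' -?ief -?ief'.
case/or3P => [/(precedesP (copy_of e') (copy_of_lt e))|/(precedesP (copy_of e) (copy_of_lt e'))|
  /(incongruentP r (copy_of e) (copy_of e'))].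
- by rewrite E ltnn.
- by rewrite E ltnn.
- by rewrite E eqxx.
Qed.

Definition design_size := \sum_e len_of e.

Theorem realizable_design p :
  realizable (p + design_size).+1 (p + design_size + #|ear_index|).
Proof.
exact: (realizable_ears p spine_ofK att_of_eq0 att_of_le len_of_gt0 cycle_length_inj).
Qed.

Lemma sum_ear_index (h : nat -> nat -> nat -> nat) :
  \sum_e h (fam_of e) (copy_of e) (slot_of e) =
  \sum_(k < size D) \sum_(i < copies r (fam k)) \sum_(j < size (fam k).2) h k i j.
Proof.
under [RHS]eq_bigr => k _ do rewrite pair_big /=.
by rewrite sig_big_dep /=.
Qed.

End Design.

(** * The construction *)

(* Sums the reaches of the spokes instead of their numbers of vertices, which are
   smaller by 1: this overestimates the size of a copy. *)
Definition family_affine (F : fan_family) : affine :=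
  foldr (fun x c => aadd x.2 c) (height F 0) (behead F.2).

Lemma sum_slots_le r (F : fan_family) i :
  \sum_(j < size F.2) (if j == 0 :> nat then aeval r (height F j) i
                       else (aeval r (reach F j) i).-1) <= aeval r (family_affine F) i.
Proof.
case: F => m [|x s]; rewrite /family_affine /height /reach /= ?big_ord0 //.
rewrite big_ord_recl /=; elim: s => [|y s IH]; first by rewrite big_ord0 addn0.
rewrite big_ord_recl /= aevalD addnCA leq_add ?leq_pred //.
Qed.

(** Doubling clears the half in the sum of the copy numbers, which is at most half the squared
    number of copies. *)
Lemma design_size_le D r : 2 * design_size D r <=
  \sum_(x <- [seq (F.1, family_affine F) | F <- D])
    (N.to_nat x.1.1 * r + N.to_nat x.1.2) *
    (2 * (N.to_nat x.2.1.1 * r + N.to_nat x.2.1.2) +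
     N.to_nat x.2.2 * (N.to_nat x.1.1 * r + N.to_nat x.1.2)).
Proof.
rewrite big_map (big_nth ((0, 0)%num, [::])) big_mkord /design_size.
rewrite (@sum_ear_index D r (fun k i j => if j == 0 then aeval r (height (fam D k) j) i
                                     else (aeval r (reach (fam D k) j) i).-1)).
rewrite big_distrr leq_sum //= => k _; rewrite -/(fam D k) -/(copies r (fam D k)).
set n := copies _ _; set c := family_affine _.
apply: (@leq_trans (2 * \sum_(i < n) aeval r c i)).
  by rewrite leq_mul2l leq_sum // => i _; apply: sum_slots_le.
rewrite /aeval big_split /= sum_nat_const card_ord -big_distrr /=.
have -> : \sum_(i < n) i = 'C(n, 2) by rewrite -bin2_sum big_mkord.
have : 2 * 'C(n, 2) <= n * n.
  have := odd_double_half (n * n.-1); rewrite bin2 -mul2n; move: _./2 => h.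
  have : n * n.-1 <= n * n by rewrite leq_mul2l leq_pred orbT.
  lia.
move: 'C(n, 2) => b; nia.
Qed.

Lemma card_ear_index D r : #|ear_index D r| =
  \sum_(F <- D) (N.to_nat F.1.1 * r + N.to_nat F.1.2) * size F.2.
Proof.
rewrite -sum1_card (@sum_ear_index D r (fun _ _ _ => 1)) (big_nth ((0, 0)%num, [::])) big_mkord.
apply: eq_bigr => k _; under eq_bigr => i _ do rewrite sum1_card card_ord.
by rewrite sum_nat_const card_ord.
Qed.

(* The parameter is r - 1, so that the constant terms are the values at r = 1
   and no coefficient is negative.  The four theta families have cycle lengths
   B + {0, 2, 4}, B + {6, 1, 3}, B + {8, 5, 7} and B + {10, 9, 11}, where B runs
   through an arithmetic progression of difference 12; a triple of numbers is the
   set of cycle lengths of a theta graph only if its sum is even.  The bounded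
   terms of the last family were found by computer search. *)
Definition design : seq fan_family := ([::
  ((24780, 29485), [:: ((0, 1, 1), (0, 1, 0))]);
  ((840, 1040), [:: ((24780, 29487, 12), (0, 1, 0));
    ((12390, 14743, 6), (12390, 14747, 6))]);
  ((840, 1040), [:: ((24780, 29493, 12), (0, 1, 0));
    ((12390, 14746, 6), (12390, 14743, 6))]);
  ((840, 1040), [:: ((24780, 29495, 12), (0, 1, 0));
    ((12390, 14747, 6), (12390, 14746, 6))]);
  ((840, 1040), [:: ((24780, 29497, 12), (0, 1, 0));
    ((12390, 14748, 6), (12390, 14749, 6))]);
  ((1260, 1240), [:: ((167160, 174266, 11), (0, 1, 0));
    ((137130, 140684, 10), (17430, 20999, 0));
    ((124530, 128092, 9), (16170, 19749, 0));
    ((111930, 115483, 8), (16170, 19729, 0));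
    ((99330, 102887, 7), (14910, 18488, 0));
    ((86730, 90295, 6), (14910, 18470, 0));
    ((74130, 77689, 5), (13650, 17201, 0));
    ((61530, 65088, 4), (13650, 17211, 0));
    ((48930, 52494, 3), (12390, 15965, 0));
    ((36330, 39890, 2), (12390, 15941, 0));
    ((23730, 27281, 1), (11130, 14688, 0))])])%num.

Lemma wf_design_design : wf_design design.
Proof. by vm_compute. Qed.

(** The extra 1 offsets the spanning tree, which has only n - 1 edges. *)
Lemma card_design r : #|ear_index design r| = (36 * (1260 * r + 1429)).+1.
Proof. rewrite card_ear_index /design !big_cons big_nil; cbn [fst snd size]; lia. Qed.

Lemma design_size_bound r n t : t = 1260 * r + 1429 ->
  (1080 * Z.of_nat t * Z.of_nat t + 175811 * Z.of_nat t + 7989 <= 2 * Z.of_nat n)%Z ->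
  design_size design r < n.
Proof.
move=> -> hn; have := design_size_le design r.
set l := map _ _; vm_compute in l.
rewrite {}/l !big_cons big_nil; cbn [fst snd]; lia.
Qed.

Theorem mainTheorem1 (r t n : nat) (hr : 1 <= r) (ht : t = 1260 * r + 169)
  (hn : (540 * INR t ^ 2 + 175811 / 2 * INR t + 7989 / 2 <= INR n)%R) :
  n + 36 * t <= max_edges n.
Proof.
(* The design takes r - 1 as parameter, and 1429 = 1260 + 169. *)
have tE : t = 1260 * r.-1 + 1429 by lia.
have hn' : (1080 * Z.of_nat t * Z.of_nat t + 175811 * Z.of_nat t + 7989 <= 2 * Z.of_nat n)%Z.
  apply: le_IZR; rewrite !plus_IZR !mult_IZR -!INR_IZR_INZ; lra.
have lt_n := design_size_bound tE hn'.
(* The padding path brings the number of vertices other than x to n - 1. *)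
have := realizable_design r.-1 wf_design_design (n.-1 - design_size design r.-1).
rewrite card_design subnK ?prednK; [|lia|lia].
have -> : n.-1 + (36 * (1260 * r.-1 + 1429)).+1 = n + 36 * t by lia.
by rewrite /max_edges; case: ex_maxnP => m _ max_m /max_m.
Qed.
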